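(* Let $\mathcal{H}$ be a Krein space, $W\in L(\mathcal{H})^{[s]}$ and let $\mathcal{S}$ be a closed subspace of $\mathcal{H}$. Suppose that $W$ is $\mathcal{S}$-weakly complementable with respect to some signature operator $J$. Then $W$ is $\mathcal{S}$-weakly complementable with respect to any other signature operator $J_\alpha$.
   Context: Hilbert spaces are complex and separable. A Krein space $(\mathcal{H},[\,\cdot,\cdot\,])$ is a linear space with a sesquilinear Hermitian form admitting a fundamental decomposition $\mathcal{H}=\mathcal{H}_+[\dotplus]\mathcal{H}_-$, an $[\,\cdot,\cdot\,]$-orthogonal direct sum in which $(\mathcal{H}_+,[\,\cdot,\cdot\,])$ and $(\mathcal{H}_-,-[\,\cdot,\cdot\,])$ are Hilbert spaces. The associated signature operator is $J=P_+-P_-$, where $P_\pm$ is the projection onto $\mathcal{H}_\pm$ with nullspace $\mathcal{H}_\mp$; it yields the Hilbert space inner product $\langle x,y\rangle=[Jx,y]$. All Hilbert norms arising this way are equivalent; $L(\mathcal{H})$ is the set of operators bounded for them. $T^{\#}$ denotes the Krein space adjoint, $[Tx,y]=[x,T^{\#}y]$, and $L(\mathcal{H})^{[s]}=\{T\in L(\mathcal{H}):T=T^{\#}\}$. If $W\in L(\mathcal{H})^{[s]}$ then $JW$ is selfadjoint in $(\mathcal{H},\langle\cdot,\cdot\rangle)$. Hilbert space notion: a bounded selfadjoint operator $B$ on a Hilbert space, with block form $B=\begin{pmatrix} a & b\\ b^* & c\end{pmatrix}$ with respect to $\mathcal{S}\oplus\mathcal{S}^\perp$, is $\mathcal{S}$-weakly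 complementable if $R(b)\subseteq R(|a|^{1/2})$, where $R(\cdot)$ is the range and $|a|=(a^*a)^{1/2}$. Krein space notion: $W\in L(\mathcal{H})^{[s]}$ is $\mathcal{S}$-weakly complementable with respect to a signature operator $J$ if $JW$ is $\mathcal{S}$-weakly complementable in the Hilbert space $(\mathcal{H},\langle\cdot,\cdot\rangle)$ associated with $J$. *)

(* Defs.v *)
From HB Require Import structures.
From mathcomp Require Import all_boot all_order all_algebra.
From mathcomp Require Import sesquilinear.
From mathcomp Require Import complex.
From mathcomp Require Import all_classical all_reals all_analysis.

Set Implicit Arguments.
Unset Strict Implicit.
Unset Printing Implicit Defensive.

Import Order.TTheory GRing.Theory Num.Theory.
Import numFieldNormedType.Exports.

Local Open Scope classical_set_scope.
Local Open Scope complex_scope.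
Local Open Scope ring_scope.

(* A Krein space carries several equivalent Hilbert norms and none of them is
   canonical, so inner products are explicit functions g, linear in the first
   variable and conjugate-linear in the second.  A Hilbert space is a pair
   (A, g) with A a linear subspace of an ambient space H, and an operator on
   (A, g) is the restriction to A of a linear map H -> H leaving A invariant. *)
Section HilbertSpaces.
Context {R : realType} {H : lmodType R[i]}.
Implicit Types (A S D : set H) (g : H -> H -> R[i]) (u : nat -> H).

Definition linear_subspace A : Prop :=
  A 0 /\ forall (k : R[i]) (x y : H), A x -> A y -> A (k *: x + y).

Definition hnorm g (x : H) : R := Num.sqrt (complex.Re (g x x)).

Definition hcvg_to g u (l : H) : Prop :=
  (fun n => hnorm g (u n - l)) @ \oo --> (0 : R).

Definition hcauchy g u : Prop :=
  forall e : R, 0 < e -> exists N : nat, forall m n : nat,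
    (N <= m)%N -> (N <= n)%N -> hnorm g (u m - u n) < e.

Definition hclosed g S : Prop :=
  forall u (l : H), (forall n, S (u n)) -> hcvg_to g u l -> S l.

Definition hcomplete A g : Prop :=
  forall u, (forall n, A (u n)) -> hcauchy g u ->
    exists2 l : H, A l & hcvg_to g u l.

Definition hseparable A g : Prop :=
  exists D, [/\ countable D, D `<=` A &
    forall (x : H) (e : R), A x -> 0 < e ->
      exists2 y : H, D y & hnorm g (x - y) < e].

Record hilbert_space A g : Prop := HilbertSpace {
  hilbert_subspace : linear_subspace A;
  hilbert_linearl : forall (k : R[i]) (x y z : H), A x -> A y -> A z ->
    g (k *: x + y) z = k * g x z + g y z;
  hilbert_conj : forall x y : H, A x -> A y -> g y x = (g x y)^*%C;
  hilbert_pos : forall x : H, A x -> x != 0 -> 0 < g x x;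
  hilbert_complete : hcomplete A g;
  hilbert_separable : hseparable A g }.

Definition orthocompl g S : set H := [set y | forall x, S x -> g x y = 0].

Definition bounded_operator A g (T : H -> H) : Prop :=
  {homo T : x / A x} /\
  exists M : R, forall x, A x -> hnorm g (T x) <= M * hnorm g x.

Definition adjoint A g (T T' : H -> H) : Prop :=
  [/\ bounded_operator A g T, bounded_operator A g T' &
      forall x y, A x -> A y -> g (T x) y = g x (T' y)].

(* On a complex space, [0 <= <Qx, x>] for all x forces Q to be selfadjoint
   (the order of R[i] makes [0 <= z] imply that z is real). *)
Definition positive_sqrt A g (T Q : H -> H) : Prop :=
  [/\ bounded_operator A g Q,
      forall x, A x -> 0 <= g (Q x) x &
      forall x, A x -> Q (Q x) = T x].

(* M = (T^* T)^(1/2) *)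
Definition absolute_value A g (T M : H -> H) : Prop :=
  exists2 T' : {linear H -> H}, adjoint A g T T' &
    positive_sqrt A g (T' \o T) M.

(* B = [[a, b], [b^*, c]] with respect to S (+) S^orth; bs stands for b^*. *)
Record block_form g S (B a b bs c : H -> H) : Prop := BlockForm {
  block_a : forall x, S x -> S (a x);
  block_b : forall y, orthocompl g S y -> S (b y);
  block_bs : forall x, S x -> orthocompl g S (bs x);
  block_c : forall y, orthocompl g S y -> orthocompl g S (c y);
  block_adj : forall x y, S x -> orthocompl g S y -> g (b y) x = g y (bs x);
  block_S : forall x, S x -> B x = a x + bs x;
  block_orth : forall y, orthocompl g S y -> B y = b y + c y }.

(* R(b) is contained in R(|a|^(1/2)), where b : S^orth -> S, m = |a| and
   q = |a|^(1/2) are operators on the Hilbert space (S, g). *)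
Definition weakly_complementable g S (B : H -> H) : Prop :=
  exists a b bs c m q : {linear H -> H},
    [/\ block_form g S B a b bs c,
        absolute_value S g a m,
        positive_sqrt S g m q &
        b @` orthocompl g S `<=` q @` S].

End HilbertSpaces.

Section KreinSpaces.
Context {R : realType} {H : lmodType R[i]}.
Variable f : {hermitian H for false & (@Num.conj R[i])}.
Implicit Types (S : set H) (W J P : {linear H -> H}).

Record fundamental_decomposition (Hp Hm : set H) : Prop :=
  FundamentalDecomposition {
  decomp_pos : hilbert_space Hp f;
  decomp_neg : hilbert_space Hm (fun x y => - f x y);
  decomp_orth : forall x y, Hp x -> Hm y -> f x y = 0;
  decomp_sum : forall z, exists x y, [/\ Hp x, Hm y & z = x + y];
  decomp_direct : Hp `&` Hm = [set 0] }.

Definition krein_space : Prop :=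
  exists Hp Hm : set H, fundamental_decomposition Hp Hm.

Definition is_projection (A B : set H) P : Prop :=
  [/\ forall x, P (P x) = P x, range P = A & P @^-1` [set 0] = B].

Definition signature_operator J : Prop :=
  exists (Hp Hm : set H) (Pp Pm : {linear H -> H}),
    [/\ fundamental_decomposition Hp Hm,
        is_projection Hp Hm Pp,
        is_projection Hm Hp Pm &
        forall x, J x = Pp x - Pm x].

Definition krein_inner J : H -> H -> R[i] := fun x y => f (J x) y.

(* The Hilbert norms of a Krein space are all equivalent, so that closedness
   and boundedness may be tested with any single signature operator. *)
Definition krein_closed S : Prop :=
  exists2 J, signature_operator J & hclosed (krein_inner J) S.

Definition krein_bounded W : Prop :=
  exists2 J, signature_operator J &
    bounded_operator setT (krein_inner J) W.

Definition krein_adjoint (T T' : {linear H -> H}) : Prop :=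
  forall x y, f (T x) y = f x (T' y).

Definition krein_selfadjoint W : Prop :=
  krein_bounded W /\ krein_adjoint W W.

Definition krein_weakly_complementable S J W : Prop :=
  weakly_complementable (krein_inner J) S (J \o W).

End KreinSpaces.

(* Main.v *)
From HB Require Import structures.
Require Import Defs.
From mathcomp Require Import all_boot all_order all_algebra.
From mathcomp Require Import sesquilinear.
From mathcomp Require Import complex.
From mathcomp Require Import all_classical all_reals all_analysis.
From mathcomp Require Import ring lra.

(* For x, y in S, the compression a of JW to S satisfies <ax, y>_J = [Wx, y], and
   weak complementability with respect to J says that for each y there is C with
   |[Wy, x]| <= C | |a|^(1/2) x |_J on S (Douglas).  Only the right-hand side depends
   on J, so it suffices to compare the quadratic forms of the moduli |a| and |a_1|
   belonging to two signature operators J and J_1.  The two Hilbert norms are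
   equivalent, so |<|a|x, y>_J| <= |x|_J |ay|_J <= C |x|_(J_1) |a_1 y|_(J_1), and
   Reid's inequality in (S, J_1) turns this into <|a|x, x>_J <= C <|a_1|x, x>_(J_1). *)

Set Implicit Arguments.
Unset Strict Implicit.
Unset Printing Implicit Defensive.

Import Order.TTheory GRing.Theory Num.Theory.
Import numFieldNormedType.Exports.

Local Open Scope classical_set_scope.
Local Open Scope complex_scope.
Local Open Scope ring_scope.

(** The orthogonal complement of [S], and with it the corner [b], changes with the signature
    operator, so corners are never compared directly. This is why the bound on [Wy, x] is required
    for every y in the space: the component of y in [S] satisfies it anyway, since the S-corner is
    controlled by its own modulus, and the resulting condition no longer mentions the complement.
    Passing from |ay| to the form of |a| resembles operator monotonicity of the square root, but |a|
    and |a_1| are selfadjoint for different inner products, so that theorem does not apply as it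
    stands. Reid's inequality only wants the form <|a|x, y>_J to be symmetric. Norm equivalence,
    square roots and projections are all derived from completeness. *)

(** * Real inequalities *)

Lemma ler_square_disc (R : realType) (a b c : R) :
  (forall t, 0 <= a + 2 * t * b + t ^+ 2 * c) -> b ^+ 2 <= a * c.
Proof.
move=> q; have a0 : 0 <= a by have := q 0; lra.
have c0 : 0 <= c.
  rewrite leNgt; apply/negP => c0.
  (* For [c < 0] this [t] makes [t ^+ 2 * c] negative enough to outweigh [a + 2 * t * b]; [1 <= t]
     absorbs the constant term [a]. *)
  have [t t1 tc] : exists2 t, 1 <= t & t * c = c - (1 + a + 2 * `|b|).
    exists ((1 + a + 2 * `|b|) / - c + 1); last by field; lra.
    by rewrite lerDr divr_ge0 ?oppr_ge0 ?(ltW c0) //; have := normr_ge0 b; lra.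
  have := q t; have -> : t ^+ 2 * c = t * (c - (1 + a + 2 * `|b|)) by rewrite -tc; ring.
  have : t * b <= t * `|b| by rewrite ler_wpM2l ?ler_norm //; lra.
  have : a <= t * a by rewrite ler_peMl.
  by have := normr_ge0 b; lra.
have [c_eq|cn] := eqVneq c 0.
  have [->|bn] := eqVneq b 0; first by rewrite c_eq expr0n /= mulr0.
  (* At this [t] the affine expression takes the value [-1]. *)
  have := q (- (1 + a) / (2 * b)); rewrite c_eq mulr0 addr0.
  have -> : 2 * (- (1 + a) / (2 * b)) * b = - (1 + a) by field.
  lra.
have cp : 0 < c by rewrite lt_neqAle eq_sym cn.
have := q (- b / c).
have -> : a + 2 * (- b / c) * b + (- b / c) ^+ 2 * c = (a * c - b ^+ 2) / c by field.
by rewrite pmulr_lge0 ?invr_gt0 // subr_ge0.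
Qed.

Lemma eq0_of_quadratic_ge0 (R : realType) (b c : R) :
  (forall t, 0 <= 2 * t * b + t ^+ 2 * c) -> b = 0.
Proof.
move=> q; have := @ler_square_disc R 0 b c; rewrite mul0r => /(_ _)/wrap[].
  by move=> t; rewrite add0r.
by move=> b0; apply/eqP; rewrite -sqrf_eq0 eq_le b0 sqr_ge0.
Qed.

Lemma cvg_dist_le (R : realType) (s w : nat -> R) (a : R) :
  (forall n, `|s n - a| <= w n) -> w @ \oo --> (0 : R) -> s @ \oo --> a.
Proof.
move=> sw /cvgrPdist_lt w0; apply/cvgrPdist_lt => eps /w0[n0 _ n0P].
exists n0 => // n /n0P /=; rewrite sub0r normrN distrC.
by apply: le_lt_trans; apply: le_trans (ler_norm _).
Qed.

(** * Linear subspaces *)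

Section Subspaces.
Context {R : realType} {H : lmodType R[i]} (S : set H).
Hypothesis subS : linear_subspace S.

Lemma subspace0 : S 0. Proof. by case: subS. Qed.
Lemma subspaceZ k x : S x -> S (k *: x).
Proof. by case: subS => S0 + Sx => /(_ k x 0 Sx S0); rewrite addr0. Qed.
Lemma subspaceD x y : S x -> S y -> S (x + y).
Proof. by case: subS => _ + Sx Sy => /(_ 1 x y Sx Sy); rewrite scale1r. Qed.
Lemma subspaceN x : S x -> S (- x).
Proof. by rewrite -scaleN1r; exact: subspaceZ. Qed.
Lemma subspaceB x y : S x -> S y -> S (x - y).
Proof. by move=> Sx Sy; apply: subspaceD => //; exact: subspaceN. Qed.

End Subspaces.

(** * Semi-inner products, their norms and convergence *)

Section SemiInnerProducts.
Context {R : realType} {H : lmodType R[i]}.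
Implicit Types (g : H -> H -> R[i]) (u v : nat -> H) (x y z : H).

(** Definiteness is kept apart because Cauchy-Schwarz is also applied to the possibly degenerate
    form [g (T x) y] of a positive [T]. *)
Record semi_inner g : Prop := SemiInner {
  semi_inner_linearl : forall (k : R[i]) x y z, g (k *: x + y) z = k * g x z + g y z;
  semi_inner_conj : forall x y, g y x = (g x y)^*%C;
  semi_inner_ge0 : forall x, 0 <= g x x }.

Definition definite_form g := forall x, g x x = 0 -> x = 0.

Variable g : H -> H -> R[i].
Hypothesis gP : semi_inner g.

Local Notation e x y := (complex.Re (g x y)).
Local Notation N x := (hnorm g x).

Lemma sipDl x y z : g (x + y) z = g x z + g y z.
Proof. by rewrite -[x]scale1r (semi_inner_linearl gP) mul1r scale1r. Qed.
Lemma sip0l z : g 0 z = 0.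
Proof. by apply: (addIr (g 0 z)); rewrite -sipDl !add0r. Qed.
Lemma sipZl k x z : g (k *: x) z = k * g x z.
Proof. by rewrite -[k *: x]addr0 (semi_inner_linearl gP) sip0l addr0. Qed.
Lemma sipNl x z : g (- x) z = - g x z.
Proof. by rewrite -scaleN1r sipZl mulN1r. Qed.
Lemma sipBl x y z : g (x - y) z = g x z - g y z.
Proof. by rewrite sipDl sipNl. Qed.
Lemma sipDr x y z : g z (x + y) = g z x + g z y.
Proof. by rewrite !(semi_inner_conj gP _ z) sipDl rmorphD. Qed.
Lemma sipZr k x z : g z (k *: x) = k^*%C * g z x.
Proof. by rewrite !(semi_inner_conj gP _ z) sipZl rmorphM. Qed.
Lemma sipNr x z : g z (- x) = - g z x.
Proof. by rewrite !(semi_inner_conj gP _ z) sipNl rmorphN. Qed.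
Lemma sipBr x y z : g z (x - y) = g z x - g z y.
Proof. by rewrite sipDr sipNr. Qed.
Lemma sip0r z : g z 0 = 0.
Proof. by rewrite (semi_inner_conj gP) sip0l conjc0. Qed.

Lemma re_sipC x y : e x y = e y x.
Proof. by rewrite (semi_inner_conj gP); case: (g y x). Qed.
Lemma re_sipDl x y z : e (x + y) z = e x z + e y z.
Proof. by rewrite sipDl; case: (g x z); case: (g y z). Qed.
Lemma re_sipNl x z : e (- x) z = - e x z.
Proof. by rewrite sipNl; case: (g x z). Qed.
Lemma re_sipZl (r : R) x z : e (r%:C *: x) z = r * e x z.
Proof. by rewrite sipZl; case: (g x z) => a b /=; rewrite mul0r subr0. Qed.
Lemma re_sipDr x y z : e z (x + y) = e z x + e z y.
Proof. by rewrite !(re_sipC z) re_sipDl. Qed.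
Lemma re_sipNr x z : e z (- x) = - e z x.
Proof. by rewrite !(re_sipC z) re_sipNl. Qed.
Lemma re_sipZr (r : R) x z : e z (r%:C *: x) = r * e z x.
Proof. by rewrite !(re_sipC z) re_sipZl. Qed.

Definition re_sipE := (re_sipDl, re_sipNl, re_sipZl,
                        re_sipDr, re_sipNr, re_sipZr).

Lemma re_sip_ge0 x : 0 <= e x x.
Proof. by have := semi_inner_ge0 gP x; rewrite lecE => /andP[]. Qed.

Lemma sipxx x : g x x = (e x x)%:C.
Proof.
by have := semi_inner_ge0 gP x; rewrite lecE; case: (g x x) => a b /= /andP[/eqP-> _].
Qed.

Lemma re_sip_CS x y : e x y ^+ 2 <= e x x * e y y.
Proof.
apply: ler_square_disc => t; have := re_sip_ge0 (x + t%:C *: y).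
by rewrite !re_sipE (re_sipC y x); congr (0 <= _); ring.
Qed.

Lemma hnorm_ge0 x : 0 <= N x. Proof. exact: sqrtr_ge0. Qed.
Lemma hnorm_sqr x : N x ^+ 2 = e x x.
Proof. by rewrite sqr_sqrtr // re_sip_ge0. Qed.

Lemma hnorm_le x (c : R) : 0 <= c -> e x x <= c ^+ 2 -> N x <= c.
Proof. by move=> c0; rewrite -hnorm_sqr ler_pXn2r // nnegrE hnorm_ge0. Qed.

Lemma re_sip_le x y : `|e x y| <= N x * N y.
Proof.
have := re_sip_CS x y; rewrite -!hnorm_sqr -exprMn -real_normK ?num_real //.
by rewrite ler_pXn2r // nnegrE ?mulr_ge0 ?hnorm_ge0.
Qed.

Lemma re_sip_ler x y : e x y <= N x * N y.
Proof. exact: le_trans (ler_norm _) (re_sip_le x y). Qed.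

Lemma ler_hnormD x y : N (x + y) <= N x + N y.
Proof.
apply: hnorm_le; first by rewrite addr_ge0 ?hnorm_ge0.
rewrite !re_sipE (re_sipC y x) sqrrD !hnorm_sqr.
have := re_sip_ler x y; lra.
Qed.

Lemma hnorm_real (r : R) x : N (r%:C *: x) = `|r| * N x.
Proof. by rewrite /hnorm !re_sipE mulrA -expr2 sqrtrM ?sqr_ge0 // sqrtr_sqr. Qed.

Lemma hnorm_opp x : N (- x) = N x.
Proof. by rewrite /hnorm !re_sipE opprK. Qed.

Lemma hnormBC x y : N (x - y) = N (y - x).
Proof. by rewrite -hnorm_opp opprB. Qed.

Lemma hnorm0 : N 0 = 0. Proof. by rewrite /hnorm sip0l sqrtr0. Qed.

Lemma hnormZ (k : R[i]) x : N (k *: x) = Normc.normc k * N x.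
Proof.
rewrite /hnorm sipZl sipZr sipxx; case: k => a b /=.
rewrite -sqrtrM ?addr_ge0 ?sqr_ge0 //; congr Num.sqrt; ring.
Qed.

Lemma ler_hnormB x y : N (x - y) <= N x + N y.
Proof. by rewrite (le_trans (ler_hnormD _ _)) // hnorm_opp. Qed.

Lemma hnorm_dist x y : `|N x - N y| <= N (x - y).
Proof.
rewrite ler_norml; apply/andP; split.
  rewrite -lerBlDr opprK addrC lerBlDr hnormBC.
  by have := ler_hnormD (y - x) x; rewrite subrK addrC.
by rewrite lerBlDr; have := ler_hnormD (x - y) y; rewrite subrK.
Qed.

Lemma hnorm_le_self (c : R) x : 0 <= c -> e x x <= c * N x -> N x <= c.
Proof.
move=> c0; rewrite -hnorm_sqr expr2; have [->//|xn] := eqVneq (N x) 0.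
by rewrite ler_pM2r // lt_neqAle eq_sym xn hnorm_ge0.
Qed.

Lemma parallelogram x y : 
  N (x - y) ^+ 2 = 2 * N x ^+ 2 + 2 * N y ^+ 2 - N (x + y) ^+ 2.
Proof. rewrite !hnorm_sqr !re_sipE (re_sipC y x); ring. Qed.

Lemma hnorm_eq0 x : definite_form g -> N x = 0 -> x = 0.
Proof. by move=> dg Nx; apply: dg; rewrite sipxx -hnorm_sqr Nx expr0n. Qed.

(* Im z = - Re ('i z), so a form is determined by its real part. *)
Lemma sip_eqP x y z t : e x y = e z t -> e ('i%C *: x) y = e ('i%C *: z) t ->
  g x y = g z t.
Proof.
rewrite !sipZl; case: (g x y) => a b; case: (g z t) => c d /= ->.
by rewrite !mul0r !sub0r !mul1r => /oppr_inj ->.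
Qed.

Lemma hcvgP u l : hcvg_to g u l <->
  forall eps : R, 0 < eps -> exists n0 : nat, forall n, (n0 <= n)%N -> N (u n - l) < eps.
Proof.
split=> [/cvgrPdist_lt ul eps eps0|ul].
  have [n0 _ n0P] := ul _ eps0; exists n0 => n n0n.
  by have := n0P n n0n; rewrite /= sub0r normrN ger0_norm ?hnorm_ge0.
apply/cvgrPdist_lt => eps /ul[n0 n0P]; exists n0 => // n /n0P.
by rewrite /= sub0r normrN ger0_norm ?hnorm_ge0.
Qed.

Lemma hcvg_squeeze u l (w : nat -> R) : w @ \oo --> (0 : R) ->
  (forall n, N (u n - l) <= w n) -> hcvg_to g u l.
Proof.
move=> w0 ul; apply: cvg_dist_le w0 => n.
by rewrite subr0 ger0_norm ?hnorm_ge0.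
Qed.

Lemma hcvg_form u l z : hcvg_to g u l -> (fun n => e (u n) z) @ \oo --> e l z.
Proof.
move=> ul; have w0 : (fun n => N (u n - l) * N z) @ \oo --> (0 : R).
  by rewrite -(mul0r (N z)); exact: cvgMr_tmp.
apply: cvg_dist_le w0 => n.
by have := re_sip_le (u n - l) z; rewrite re_sipDl re_sipNl.
Qed.

Lemma hcvg_norm u l : hcvg_to g u l -> (fun n => N (u n)) @ \oo --> N l.
Proof.
by move=> ul; apply: cvg_dist_le ul => n; exact: hnorm_dist.
Qed.

Lemma hcvgD u v l m : hcvg_to g u l -> hcvg_to g v m ->
  hcvg_to g (fun n => u n + v n) (l + m).
Proof.
move=> ul vm.
have w0 : (fun n => N (u n - l) + N (v n - m)) @ \oo --> (0 : R).
  by rewrite -(addr0 0); exact: cvgD ul vm.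
apply: (hcvg_squeeze w0) => n; rewrite opprD addrACA; exact: ler_hnormD.
Qed.

Lemma hcvgZ k u l : hcvg_to g u l -> hcvg_to g (fun n => k *: u n) (k *: l).
Proof.
move=> ul; have w0 : (fun n => Normc.normc k * N (u n - l)) @ \oo --> (0 : R).
  by rewrite -(mulr0 (Normc.normc k)); exact: cvgMl_tmp.
by apply: (hcvg_squeeze w0) => n; rewrite -scalerBr hnormZ.
Qed.

Lemma hcvg_cst l : hcvg_to g (fun=> l) l.
Proof. by rewrite /hcvg_to subrr hnorm0; exact: cvg_cst. Qed.

Lemma hcvg_unique u l m : definite_form g -> hcvg_to g u l -> hcvg_to g u m -> l = m.
Proof.
move=> dg ul um; apply/eqP; rewrite -subr_eq0; apply/eqP/hnorm_eq0 => //.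
apply/eqP; rewrite eq_le hnorm_ge0 andbT.
have := hcvgD ul (hcvgZ (-1) um); rewrite !scaleN1r => lm.
have := hcvg_norm lm.
rewrite (_ : (fun n => _) = fun=> 0); last first.
  by apply/funext => n; rewrite scaleN1r subrr hnorm0.
by move=> /(cvg_unique _ (cvg_cst 0)) <-.
Qed.

End SemiInnerProducts.

Lemma linear_exists (K : pzRingType) (U V : lmodType K) (F : U -> V) :
  (forall k x y, F (k *: x + y) = k *: F x + F y) ->
  exists L : {linear U -> V}, forall x, L x = F x.
Proof.
move=> linF; pose L : {linear U -> V} := HB.pack_for {linear U -> V} F
  (GRing.isLinear.Build K U V *:%R F linF).
by exists L.
Qed.

(** * Riesz representation and orthogonal projections *)

Section CompleteForms.
Context {R : realType} {H : lmodType R[i]}.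
Implicit Types (x y z : H) (S : set H) (L T Q : {linear H -> H}).
Variable g : H -> H -> R[i].
Hypotheses (gP : semi_inner g) (gD : definite_form g) (gC : hcomplete setT g).

Local Notation e x y := (complex.Re (g x y)).
Local Notation N x := (hnorm g x).

Lemma hnorm_lim_le (u : nat -> H) l (c : R) : hcvg_to g u l -> (forall n, N (u n) <= c) -> N l <= c.
Proof.
move=> ul uc; apply: (ler_cvg_to (hcvg_norm gP ul) (cvg_cst c)).
exact: nearW.
Qed.

Lemma hcvg_sqr_dist (u : nat -> H) (w : nat -> R) : w @ \oo --> (0 : R) ->
  (forall m n, (m <= n)%N -> N (u m - u n) ^+ 2 <= w m) -> exists l, hcvg_to g u l.
Proof.
move=> /cvgrPdist_lt w0 uw.
suff cu : hcauchy g u by have [//|l _ ul] := gC _ cu; exists l.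
move=> eps eps0; have e20 : 0 < eps ^+ 2 by rewrite exprn_gt0.
have [n0 _ n0P] := w0 _ e20; exists n0.
suff step m n : (n0 <= m)%N -> (m <= n)%N -> N (u m - u n) < eps.
  move=> m n n0m n0n; have [mn|/ltnW nm] := leqP m n; first exact: step.
  by rewrite hnormBC // step.
move=> n0m mn; rewrite -(@ltr_pXn2r _ 2) ?nnegrE ?hnorm_ge0 ?ltW //.
apply: le_lt_trans (uw _ _ mn) _; apply: le_lt_trans (ler_norm _) _.
by have := n0P m n0m; rewrite /= sub0r normrN.
Qed.

(* Minimise |Lx|^2 - 2 Re psi(x) over A; a minimising sequence is Cauchy by the
   parallelogram identity, and the first variation identifies the limit. *)
Lemma riesz (A : set H) L (psi : H -> R[i]) (C : R) : linear_subspace A ->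
  (forall k x y, A x -> A y -> psi (k *: x + y) = k^*%C * psi x + psi y) ->
  0 <= C -> (forall x, A x -> complex.Re (psi x) <= C * N (L x)) ->
  exists u, [/\ exists2 v : nat -> H, (forall n, A (v n)) & hcvg_to g (L \o v) u,
    N u <= C & forall x, A x -> g u (L x) = psi x].
Proof.
move=> Asub psiL C0 psiC.
have A0 := subspace0 Asub.
have psi0 : psi 0 = 0.
  by have := psiL (-1) 0 0 A0 A0; rewrite scaler0 addr0 rmorphN1 mulN1r addNr.
have psiZ k x : A x -> psi (k *: x) = k^*%C * psi x.
  by move=> Ax; have := psiL k x 0 Ax A0; rewrite psi0 !addr0.
have rpsiZ (r : R) x : A x -> complex.Re (psi (r%:C *: x)) = r * complex.Re (psi x).
  by move=> Ax; rewrite psiZ //; case: (psi x) => a b /=; rewrite oppr0 mul0r subr0.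
have rpsiD x y : A x -> A y ->
    complex.Re (psi (x + y)) = complex.Re (psi x) + complex.Re (psi y).
  move=> Ax Ay; have := psiL 1 x y Ax Ay; rewrite scale1r conjc1 mul1r => ->.
  by case: (psi x) => a b; case: (psi y).
pose F x := N (L x) ^+ 2 - 2 * complex.Re (psi x).
pose E := F @` A.
(* Completing the square: [F x] is at least [(N (L x) - C) ^+ 2 - C ^+ 2]. *)
have Elb : lbound E (- C ^+ 2).
  move=> _ [x Ax <-]; rewrite /F; have := psiC x Ax.
  have := sqr_ge0 (N (L x) - C); rewrite sqrrB; lra.
have infE : has_inf E by split; [exists (F 0), 0|exists (- C ^+ 2)].
set d := inf E.
have dF x : A x -> d <= F x by move=> Ax; apply: ge_inf; [case: infE|exists x].
have /choice[v vP] (n : nat) : exists x, A x /\ F x < d + n.+1%:R^-1.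
  have n0 : 0 < n.+1%:R^-1 :> R by rewrite invr_gt0.
  by have [_ [x Ax <-] ?] := inf_adherent n0 infE; exists x.
have Av n : A (v n) by case: (vP n).
have vF n : F (v n) < d + n.+1%:R^-1 by case: (vP n).
have cvgLv : exists u, hcvg_to g (L \o v) u.
  (* Comparing with [F] at the midpoint of [v m] and [v n], the linear terms cancel and the
     parallelogram identity leaves twice the two errors, at most [4 / (m + 1)]. *)
  apply: (@hcvg_sqr_dist _ (fun n => 4 * n.+1%:R^-1)).
    by rewrite -(mulr0 4); apply: cvgMl_tmp; exact: cvg_harmonic.
  move=> m n mn /=; rewrite parallelogram //.
  have Amn := subspaceD Asub (Av m) (Av n).
  have LZ : L (2^-1%:C *: (v m + v n)) = 2^-1%:C *: (L (v m) + L (v n)).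
    by rewrite linearZ linearD.
  have := dF _ (subspaceZ Asub 2^-1%:C Amn).
  rewrite /F LZ rpsiZ ?rpsiD ?hnorm_real //.
  have := vF m; have := vF n; rewrite /F.
  have : n.+1%:R^-1 <= m.+1%:R^-1 :> R by rewrite lef_pV2 ?posrE ?ltr0n ?ler_nat.
  rewrite ger0_norm ?invr_ge0 // exprMn.
  move: (m.+1%:R^-1 : R) (n.+1%:R^-1 : R) => wm wn; lra.
have [u Lvu] := cvgLv; exists u.
have re_u x : A x -> e u (L x) = complex.Re (psi x).
  move=> Ax; apply/eqP; rewrite -subr_eq0; apply/eqP.
  apply: (@eq0_of_quadratic_ge0 _ _ (N (L x) ^+ 2)) => t.
  (* [w n] is [F (v n + t x) - F (v n)] plus the error [1 / (n + 1)] of the minimising sequence,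
     hence nonnegative. *)
  pose w n := n.+1%:R^-1 + (2 * t * (e (L (v n)) (L x) - complex.Re (psi x))
     + t ^+ 2 * N (L x) ^+ 2).
  have w0 : w @ \oo --> 0 + (2 * t * (e u (L x) - complex.Re (psi x))
     + t ^+ 2 * N (L x) ^+ 2).
    have eu : (fun n => e (L (v n)) (L x) - complex.Re (psi x)) @ \oo -->
      e u (L x) - complex.Re (psi x).
      exact: (cvgB (hcvg_form (z := L x) gP Lvu) (cvg_cst _)).
    apply: cvgD; first exact: cvg_harmonic.
    by apply: cvgD; [exact: cvgMl_tmp|exact: cvg_cst].
  rewrite -[leRHS]add0r; apply: (ler_cvg_to (cvg_cst 0) w0); apply: nearW => n.
  have Atx := subspaceZ Asub t%:C Ax.
  have := dF _ (subspaceD Asub (Av n) Atx); have := vF n; rewrite /F /w.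
  have -> : L (v n + t%:C *: x) = L (v n) + t%:C *: L x by rewrite linearD linearZ.
  rewrite rpsiD // rpsiZ // !hnorm_sqr // !re_sipE //.
  by rewrite (re_sipC gP (L x)); move: (n.+1%:R^-1 : R) => wn; lra.
have gu x : A x -> g u (L x) = psi x.
  move=> Ax; have := re_u _ Ax; have := re_u _ (subspaceZ Asub 'i%C Ax).
  rewrite linearZ /= sipZr // psiZ //.
  case: (g u (L x)) => a b; case: (psi x) => c d' /=.
  by rewrite !mul0r !sub0r !mulN1r !opprK => -> ->.
split=> //; first by exists v.
apply: (hnorm_le_self gP C0).
have NL : (fun n => C * N (L (v n))) @ \oo --> C * N u.
  by apply: cvgMl_tmp; exact: (hcvg_norm gP Lvu).
apply: (ler_cvg_to (hcvg_form (z := u) gP Lvu) NL); apply: nearW => n /=.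
by rewrite re_sipC // re_u // psiC.
Qed.

Lemma subspace_sip_inj S x y : linear_subspace S -> S x -> S y ->
  (forall z, S z -> g x z = g y z) -> x = y.
Proof.
move=> Ssub Sx Sy xy; apply/eqP; rewrite -subr_eq0; apply/eqP/gD.
by have Sxy := subspaceB Ssub Sx Sy; rewrite sipBl // xy // subrr.
Qed.

Definition orthoprojector S (P : {linear H -> H}) :=
  [/\ forall x, S (P x), forall x, S x -> P x = x &
      forall x y, S y -> g (P x) y = g x y].

(** Riesz with [L] the identity: the representer of [g x] on [S] is a limit of vectors of [S], so
    closedness keeps it there. *)
Lemma orthoprojector_exists S : linear_subspace S -> hclosed g S ->
  exists P, orthoprojector S P.
Proof.
move=> Ssub Scl.
have /choice[P PP] x : exists p, S p /\ forall y, S y -> g p y = g x y.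
  have [||| p [[v Sv vp] _ gp]] :=
    @riesz S (@idfun H : {linear H -> H}) (g x) (N x) Ssub.
  - by move=> k y z _ _; rewrite sipDr // sipZr.
  - exact: hnorm_ge0.
  - by move=> y _; exact: re_sip_ler.
  by exists p; split=> //; apply: Scl vp.
have SP x : S (P x) by case: (PP x).
have gPx x y : S y -> g (P x) y = g x y by case: (PP x) => _; apply.
have uniqS := subspace_sip_inj Ssub.
have [L LP] : exists L : {linear H -> H}, forall x, L x = P x.
  apply: linear_exists => k x y; apply: uniqS => //.
    by apply: subspaceD => //; exact: subspaceZ.
  by move=> z Sz; rewrite sipDl // sipZl // !gPx // sipDl // sipZl.
exists L; split=> [x|x Sx|x y Sy]; rewrite LP //.
- by apply: uniqS => // y Sy; exact: gPx.
- exact: gPx.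
Qed.

Lemma hnorm_proj S P x : orthoprojector S P -> N (P x) <= N x.
Proof.
move=> [SP _ gPx]; apply: (hnorm_le_self gP (hnorm_ge0 _ _)).
by rewrite gPx // re_sip_ler.
Qed.

End CompleteForms.

(** * The square root iteration *)

Section SquareRoot.
Context {R : realType} {H : lmodType R[i]}.
Implicit Types (x y z : H) (S : set H) (B T Q : {linear H -> H}).

(** A fixed point of [Y = (B + Y^2) / 2] satisfies [(1 - Y)^2 = 1 - B]. *)
Fixpoint sqrt_iter (B : H -> H) (n : nat) (x : H) : H :=
  if n is m.+1 then (2^-1)%:C *: (B x + sqrt_iter B m (sqrt_iter B m x)) else 0.

(** The same recursion for the scalar [B = 1]. It dominates the iterates of every contraction and
    converges by monotonicity. *)
Fixpoint sqrt_majorant (n : nat) : R :=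
  if n is m.+1 then 2^-1 * (1 + sqrt_majorant m ^+ 2) else 0.

Local Notation w := sqrt_majorant.

Lemma sqrt_majorant_itv n : 0 <= w n <= 1.
Proof.
by elim: n => [|n /andP[w0 w1]] /=; [lra|apply/andP; split; nra].
Qed.

Lemma sqrt_majorant_nd : nondecreasing_seq w.
Proof.
apply/nondecreasing_seqP => n /=; have := sqr_ge0 (w n - 1).
rewrite sqrrB; lra.
Qed.

Lemma sqrt_majorant_tail : (fun n => limn w - w n) @ \oo --> (0 : R).
Proof.
have cw : cvgn w.
  apply: nondecreasing_is_cvgn; first exact: sqrt_majorant_nd.
  by exists 1 => _ [n _ <-]; case/andP: (sqrt_majorant_itv n).
rewrite -(subrr (limn w)); exact: cvgB (cvg_cst _) cw.
Qed.

Lemma sqrt_majorant_lim n : w n <= limn w.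
Proof.
apply: nondecreasing_cvgn_le; first exact: sqrt_majorant_nd.
apply: nondecreasing_is_cvgn; first exact: sqrt_majorant_nd.
by exists 1 => _ [m _ <-]; case/andP: (sqrt_majorant_itv m).
Qed.

Variable g : H -> H -> R[i].
Hypotheses (gP : semi_inner g) (gD : definite_form g) (gC : hcomplete setT g).

Local Notation e x y := (complex.Re (g x y)).
Local Notation N x := (hnorm g x).

Section Iteration.
Variable B : {linear H -> H}.
Hypothesis B1 : forall x, N (B x) <= N x.
Local Notation Y := (sqrt_iter B).

Lemma sqrt_iter_linear n k x y : Y n (k *: x + y) = k *: Y n x + Y n y.
Proof.
elim: n k x y => [|n IH] k x y /=; first by rewrite scaler0 addr0.
rewrite !IH linearP !scalerDr !scalerA mulrC -!addrA; congr (_ + _).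
by rewrite addrCA.
Qed.

Lemma sqrt_iterB n x y : Y n (x - y) = Y n x - Y n y.
Proof. by rewrite addrC -scaleN1r sqrt_iter_linear scaleN1r addrC. Qed.

Lemma sqrt_iter_norm n x : N (Y n x) <= w n * N x.
Proof.
elim: n x => [|n IH] x /=; first by rewrite hnorm0 // mul0r.
rewrite hnorm_real // ger0_norm ?invr_ge0 // -mulrA ler_wpM2l ?invr_ge0 //.
apply: le_trans (ler_hnormD gP _ _) _; rewrite mulrDl mul1r lerD //.
apply: le_trans (IH _) _; rewrite expr2 -mulrA ler_wpM2l //.
by case/andP: (sqrt_majorant_itv n).
Qed.

Lemma sqrt_iter_norm1 n x : N (Y n x) <= N x.
Proof.
apply: le_trans (sqrt_iter_norm n x) _; rewrite ler_piMl ?hnorm_ge0 //.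
by case/andP: (sqrt_majorant_itv n).
Qed.

(** [Y'^2 - Y^2 = (Y' - Y) Y' + Y (Y' - Y)] holds without commutation, and the scalar recursion
    satisfies the same identity, so the norm estimate follows termwise. *)
Lemma sqrt_iter_step n x : N (Y n.+1 x - Y n x) <= (w n.+1 - w n) * N x.
Proof.
elim: n x => [|n IH] x.
  rewrite /= !addr0 !subr0 expr0n addr0 mulr1 hnorm_real // ger0_norm ?invr_ge0 //.
  by rewrite ler_wpM2l ?invr_ge0.
have -> : Y n.+2 x - Y n.+1 x = (2^-1)%:C *: ((Y n.+1 (Y n.+1 x) - Y n (Y n.+1 x))
    + Y n (Y n.+1 x - Y n x)).
  rewrite sqrt_iterB addrA subrK.
  have E a b c : (2^-1)%:C *: (c + a) - (2^-1)%:C *: (c + b) = (2^-1)%:C *: (a - b) :> H.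
    by rewrite -scalerBr opprD addrACA subrr add0r.
  exact: (E _ _ (B x)).
have -> : w n.+2 - w n.+1 = 2^-1 * ((w n.+1 - w n) * w n.+1 + w n * (w n.+1 - w n)).
  have E (a b : R) : 2^-1 * (1 + a ^+ 2) - 2^-1 * (1 + b ^+ 2)
    = 2^-1 * ((a - b) * a + b * (a - b)) by ring.
  exact: E.
rewrite hnorm_real // ger0_norm ?invr_ge0 // -mulrA ler_wpM2l ?invr_ge0 //.
have w01 := sqrt_majorant_itv n.
have dw : 0 <= w n.+1 - w n by rewrite subr_ge0 sqrt_majorant_nd.
apply: le_trans (ler_hnormD gP _ _) _; rewrite mulrDl lerD //.
  apply: le_trans (IH _) _; rewrite -mulrA ler_wpM2l //; exact: sqrt_iter_norm.
apply: le_trans (sqrt_iter_norm _ _) _; rewrite -mulrA ler_wpM2l //.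
by case/andP: w01.
Qed.

Lemma sqrt_iter_dist m n x : (m <= n)%N -> N (Y m x - Y n x) <= (w n - w m) * N x.
Proof.
elim: n => [|n IH]; first by rewrite leqn0 => /eqP->; rewrite !subrr hnorm0 // mul0r.
rewrite leq_eqVlt => /predU1P[->|]; first by rewrite !subrr hnorm0 // mul0r.
rewrite ltnS => /IH {}IH; rewrite -[Y m x](subrK (Y n x)) -addrA.
apply: le_trans (ler_hnormD gP _ _) _; rewrite (hnormBC gP (Y n x)).
have := sqrt_iter_step n x; move: IH; rewrite !mulrBl; lra.
Qed.

Lemma sqrt_iter_cvg x : exists l, hcvg_to g (fun n => Y n x) l.
Proof.
have w0 : (fun n => (limn w - w n) * (N x ^+ 2)) @ \oo --> (0 : R).
  by rewrite -(mul0r (N x ^+ 2)); apply: cvgMr_tmp; exact: sqrt_majorant_tail.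
apply: (hcvg_sqr_dist gP gC w0) => m n mn.
have lm := sqrt_majorant_lim n; have := sqrt_majorant_nd mn.
have /andP[wm0 wm1] := sqrt_majorant_itv m; have /andP[wn0 wn1] := sqrt_majorant_itv n.
move=> wmn; apply: (@le_trans _ _ (((w n - w m) * N x) ^+ 2)).
  rewrite ler_pXn2r ?nnegrE ?hnorm_ge0 ?mulr_ge0 ?subr_ge0 ?hnorm_ge0 //.
  exact: sqrt_iter_dist.
(* A difference of two majorants lies in [0, 1], so its square is at most itself. *)
rewrite exprMn ler_wpM2r ?sqr_ge0 // expr2.
apply: (@le_trans _ _ (1 * (w n - w m))); last by rewrite mul1r lerD2r.
by rewrite ler_wpM2r // ?subr_ge0 //; lra.
Qed.

Lemma sqrt_iter_sym n : (forall x y, g (B x) y = g x (B y)) ->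
  forall x y, g (Y n x) y = g x (Y n y).
Proof.
move=> Bs; elim: n => [|n IH] x y /=; first by rewrite sip0l // sip0r.
by rewrite sipZl // sipZr // sipDl // sipDr // Bs !IH conjc_real.
Qed.

End Iteration.

(** In [R[i]] the relation [0 <= z] includes that [z] is real; symmetry supplies this. *)
Lemma sip_ge0_of_sym Q x : (forall x y, g (Q x) y = g x (Q y)) ->
  0 <= e (Q x) x -> 0 <= g (Q x) x.
Proof.
move=> Qs Qx; have : g (Q x) x = (g (Q x) x)^*%C by rewrite {1}Qs (semi_inner_conj gP).
by case: (g (Q x) x) Qx => a b /= a0 [] b0; rewrite lecE /= a0 andbT; apply/eqP; lra.
Qed.

Lemma semi_inner_comp T : (forall x y, g (T x) y = g x (T y)) ->
  (forall x, 0 <= g (T x) x) -> semi_inner (fun x y => g (T x) y).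
Proof.
move=> Ts T0; split=> // [k x y z|x y].
  by rewrite linearP (semi_inner_linearl gP).
by rewrite Ts (semi_inner_conj gP).
Qed.

(** Cauchy-Schwarz for [g (T x) y] gives |Tx|^4 <= <Tx, x> <TTx, Tx> <= <Tx, x> |Tx|^2, so |Tx|^2 <=
    <Tx, x>, which the cross term of |x - Tx|^2 absorbs. *)
Lemma positive_contraction T x : (forall x y, g (T x) y = g x (T y)) ->
  (forall x, 0 <= g (T x) x) -> (forall x, N (T x) <= N x) -> N (x - T x) <= N x.
Proof.
move=> Ts T0 T1; apply: hnorm_le => //; first exact: hnorm_ge0.
rewrite !re_sipE // hnorm_sqr // (re_sipC gP x (T x)).
have := re_sip_CS (semi_inner_comp Ts T0) x (T x) => /= CS.
have TT : e (T (T x)) (T x) <= e (T x) (T x).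
  rewrite -[leRHS]hnorm_sqr // expr2; apply: le_trans (re_sip_ler gP _ _) _.
  by rewrite ler_wpM2r ?hnorm_ge0.
have Tx0 : 0 <= e (T x) x by have := T0 x; rewrite lecE => /andP[].
have [T00|Tn] := eqVneq (e (T x) (T x)) 0; first by rewrite T00; lra.
have Tp : 0 < e (T x) (T x) by rewrite lt_neqAle eq_sym Tn re_sip_ge0.
suff : e (T x) (T x) <= e (T x) x by lra.
rewrite -(ler_pM2r Tp) -expr2; apply: le_trans CS _.
by rewrite ler_wpM2l.
Qed.

End SquareRoot.

(** * Existence of positive square roots *)

Section SquareRootExists.
Context {R : realType} {H : lmodType R[i]}.
Implicit Types (x y z : H) (S : set H) (B T Q : {linear H -> H}).
Variable g : H -> H -> R[i].
Hypotheses (gP : semi_inner g) (gD : definite_form g) (gC : hcomplete setT g).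

Local Notation e x y := (complex.Re (g x y)).
Local Notation N x := (hnorm g x).

(* With B = 1 - T a contraction, the iteration Y' = (B + Y^2)/2 converges in
   operator norm, and 1 - lim Y is the square root. *)
Lemma sqrt_contraction S T : linear_subspace S -> hclosed g S ->
  (forall x y, g (T x) y = g x (T y)) -> (forall x, 0 <= g (T x) x) ->
  (forall x, N (T x) <= N x) -> {homo T : x / S x} ->
  exists Q, [/\ {homo Q : x / S x}, forall x y, g (Q x) y = g x (Q y),
    forall x, 0 <= g (Q x) x, forall x, Q (Q x) = T x &
    forall x, N (Q x) <= 2 * N x].
Proof.
move=> Ssub Scl Ts T0 T1 TS.
have [B BE] : exists B : {linear H -> H}, forall x, B x = x - T x.
  apply: linear_exists => k x y; rewrite linearP scalerBr opprD addrACA.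
  by [].
have B1 x : N (B x) <= N x by rewrite BE; exact: positive_contraction.
have Bs x y : g (B x) y = g x (B y) by rewrite !BE sipBl // sipBr // Ts.
have /choice[Yl YlP] x := sqrt_iter_cvg gP gC B1 x.
have Yl_lin k x y : Yl (k *: x + y) = k *: Yl x + Yl y.
  apply: (hcvg_unique gP gD (YlP _)).
  have := hcvgD gP (hcvgZ gP k (YlP x)) (YlP y).
  congr (hcvg_to g _ _); apply/funext => n; exact/esym/sqrt_iter_linear.
have Yl1 x : N (Yl x) <= N x.
  by apply: (hnorm_lim_le gP (YlP x)) => n; exact: sqrt_iter_norm1.
have Yl_sym x y : e (Yl x) y = e x (Yl y).
  have xy := hcvg_form (z := y) gP (YlP x).
  have yx := hcvg_form (z := x) gP (YlP y).
  have E : (fun n => e (sqrt_iter B n x) y) = fun n => e (sqrt_iter B n y) x.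
    by apply/funext => n; rewrite (re_sipC gP) sqrt_iter_sym.
  rewrite (re_sipC gP x); rewrite E in xy; exact: (cvg_unique _ xy yx).
have YlS x : S x -> S (Yl x).
  move=> Sx; apply: Scl (YlP x) => n.
  elim: n x Sx => [|n IH] x Sx /=; first exact: subspace0.
  apply: subspaceZ => //; apply: subspaceD; [by []| |exact/IH/IH].
  by rewrite BE; apply: subspaceB => //; exact: TS.
have Yl_fix x : Yl x = (2^-1)%:C *: (B x + Yl (Yl x)).
  (* The iterates are contractions, so replacing the inner iterate by its limit costs at most their
     distance. *)
  have YY : hcvg_to g (fun n => sqrt_iter B n (sqrt_iter B n x)) (Yl (Yl x)).
    have w0 : (fun n => N (sqrt_iter B n x - Yl x)
        + N (sqrt_iter B n (Yl x) - Yl (Yl x))) @ \oo --> (0 : R).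
      by rewrite -(addr0 0); apply: cvgD; exact: YlP.
    apply: (hcvg_squeeze w0) => n.
    rewrite -[X in X - _](subrK (sqrt_iter B n (Yl x))) -addrA.
    apply: le_trans (ler_hnormD gP _ _) _; rewrite lerD2r -sqrt_iterB.
    exact: sqrt_iter_norm1.
  (* The averaged sequence is that of the iterates shifted by one, whence [n0P n.+1]. *)
  apply: (hcvg_unique gP gD _ (hcvgZ gP (2^-1)%:C (hcvgD gP (hcvg_cst gP (B x)) YY))).
  apply/hcvgP => eps; have /hcvgP ux := YlP x => /ux[n0 n0P].
  by exists n0 => n n0n; exact/(n0P n.+1)/leqW.
have [Q QE] : exists Q : {linear H -> H}, forall x, Q x = x - Yl x.
  apply: linear_exists => k x y; rewrite Yl_lin scalerBr opprD addrACA.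
  by [].
have Qre x y : e (Q x) y = e x (Q y) by rewrite !QE !re_sipE // Yl_sym.
have Qs x y : g (Q x) y = g x (Q y).
  by apply: sip_eqP => //; rewrite -?linearZ /= Qre.
exists Q; split=> // [x Sx|x|x|x].
- by rewrite QE; apply: subspaceB => //; exact: YlS.
- apply: sip_ge0_of_sym => //; rewrite QE !re_sipE //.
  rewrite subr_ge0; apply: le_trans (re_sip_ler gP _ _) _.
  by rewrite -hnorm_sqr // expr2 ler_wpM2r ?hnorm_ge0.
- have := Yl_fix x; rewrite !QE BE => E.
  have YlB : Yl (x - Yl x) = Yl x - Yl (Yl x).
    by rewrite addrC -scaleN1r Yl_lin scaleN1r addrC.
  have E2 : Yl x + Yl x = x - T x + Yl (Yl x).
    rewrite {1 2}E -scalerDl -rmorphD /= -[RHS]scale1r; congr (_ *: _).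
    by rewrite -[RHS]/(1%:C); congr (_%:C); lra.
  by rewrite YlB opprB addrACA -opprD E2 [_ - T x + _]addrAC opprB addrC subrK.
- rewrite QE; apply: le_trans (ler_hnormB gP _ _) _.
  by have := Yl1 x; lra.
Qed.

Lemma sqrt_exists S T (M : R) : linear_subspace S -> hclosed g S ->
  (forall x y, g (T x) y = g x (T y)) -> (forall x, 0 <= g (T x) x) ->
  (forall x, N (T x) <= M * N x) -> {homo T : x / S x} ->
  exists Q, [/\ {homo Q : x / S x}, forall x y, g (Q x) y = g x (Q y),
    forall x, 0 <= g (Q x) x, forall x, Q (Q x) = T x &
    exists K : R, forall x, N (Q x) <= K * N x].
Proof.
move=> Ssub Scl Ts T0 TM TS.
(* The maximum makes [c] positive whatever [M] is. [T / c] is then a contraction, and its root is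
   scaled back by the square root of [c]. *)
pose c := Num.max M 1; have c0 : 0 < c by rewrite lt_max ltr01 orbT.
have [T' T'E] : exists T' : {linear H -> H}, forall x, T' x = (c^-1)%:C *: T x.
  by apply: linear_exists => k x y; rewrite linearP scalerDr !scalerA mulrC.
have [||||Q [QS Qs Q0 QQ Q2]] := @sqrt_contraction S T' Ssub Scl.
- by move=> x y; rewrite !T'E sipZl // sipZr // conjc_real Ts.
- by move=> x; rewrite T'E sipZl // mulr_ge0 // ler0c invr_ge0 ltW.
- move=> x; rewrite T'E hnorm_real // ger0_norm ?invr_ge0 ?(ltW c0) // ler_pdivrMl //.
  apply: le_trans (TM x) _; rewrite ler_wpM2r ?hnorm_ge0 //.
  by rewrite le_max lexx.
- by move=> x Sx; rewrite T'E; apply: subspaceZ => //; exact: TS.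
have s0 : 0 <= Num.sqrt c by exact: sqrtr_ge0.
have [Q' Q'E] : exists Q' : {linear H -> H}, forall x, Q' x = (Num.sqrt c)%:C *: Q x.
  by apply: linear_exists => k x y; rewrite linearP scalerDr !scalerA mulrC.
exists Q'; split.
- by move=> x Sx; rewrite Q'E; apply: subspaceZ => //; exact: QS.
- by move=> x y; rewrite !Q'E sipZl // sipZr // conjc_real Qs.
- by move=> x; rewrite Q'E sipZl // mulr_ge0 // ler0c.
- move=> x; rewrite !Q'E linearZ /= QQ T'E !scalerA -!rmorphM /= -expr2.
  by rewrite sqr_sqrtr ?(ltW c0) // divff ?scale1r // gt_eqF.
- exists (Num.sqrt c * 2) => x.
  by rewrite Q'E hnorm_real // ger0_norm // -mulrA ler_wpM2l.
Qed.

End SquareRootExists.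

(** * Reid's inequality and Douglas' range criterion *)

(** Were [b 0] above [t > 0], then [b n.+1 >= b n ^+ 2 / t] would push the excess over [t] past
    every bound. *)
Lemma ler_of_bounded_squaring (R : realType) (b : nat -> R) (t M : R) : 0 <= t ->
  (forall n, b n ^+ 2 <= t * b n.+1) -> (forall n, b n <= M) -> b 0%N <= t.
Proof.
move=> t0 bb bM; rewrite leNgt; apply/negP => tb.
have [t00|tn] := eqVneq t 0.
  have := bb 0%N; rewrite t00 mul0r => /(conj (sqr_ge0 (b 0%N)))/andP.
  by rewrite -eq_le eq_sym sqrf_eq0 => /eqP b0; move: tb; rewrite b0 t00 ltxx.
have tp : 0 < t by rewrite lt_neqAle eq_sym tn.
pose d := b 0%N - t; have d0 : 0 < d by rewrite subr_gt0.
(* Linear growth suffices. The induction rests on [2 * (n + 1) >= n + 2]. *)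
have bn n : t + n.+1%:R * d <= b n.
  elim: n => [|n IH]; first by rewrite mul1r /d addrC subrK.
  rewrite -(ler_pM2l tp); apply: le_trans (bb n).
  have dn : 0 <= n.+1%:R * d by rewrite mulr_ge0 // ltW.
  apply: (@le_trans _ _ ((t + n.+1%:R * d) ^+ 2)); last first.
    by rewrite ler_pXn2r // nnegrE; [lra|apply: le_trans IH; lra].
  have : 0 <= t * (n%:R * d) by rewrite !mulr_ge0 // ltW.
  have := sqr_ge0 (n.+1%:R * d); rewrite sqrrD -!natr1; lra.
have := archi_boundP (normr_ge0 (M / d)); move: (Num.bound _) => k.
move=> /(le_lt_trans (ler_norm _)); rewrite ltr_pdivrMr // => Mk.
have := bM k; have := bn k; rewrite -natr1 mulrDl mul1r; lra.
Qed.

Section Reid.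
Context {R : realType} {H : lmodType R[i]}.
Variable g : H -> H -> R[i].
Hypotheses (gP : semi_inner g) (gC : hcomplete setT g).

Local Notation e x y := (complex.Re (g x y)).
Local Notation N x := (hnorm g x).

(* Reid's inequality.  The Riesz lemma yields Z with |Z| <= C and
   <Zx, Q^2 y> = alpha(x, y); then t_k = <Q x, Q Z^k x> is a moment sequence with
   t_{i+j}^2 <= t_{2i} t_{2j} and t_k = O(C^k), whence t_1 <= C t_0. *)
Lemma reid (S : set H) (Q : {linear H -> H}) (alpha : H -> H -> R[i]) (C K : R) :
  linear_subspace S -> hclosed g S -> {homo Q : x / S x} ->
  (forall x y, S x -> S y -> g (Q x) y = g x (Q y)) ->
  (forall x, S x -> N (Q x) <= K * N x) ->
  (forall k x y z, S x -> S y -> S z ->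
     alpha x (k *: y + z) = k^*%C * alpha x y + alpha x z) ->
  (forall x y, S x -> S y -> complex.Re (alpha x y) = complex.Re (alpha y x)) ->
  0 < C ->
  (forall x y, S x -> S y -> complex.Re (alpha x y) <= C * N x * N (Q (Q y))) ->
  forall x, S x -> complex.Re (alpha x x) <= C * N (Q x) ^+ 2.
Proof.
move=> Ssub Scl QS Qs QK alin asym C0 aC x Sx.
(* The premise [S z] lets the choice range over all of [H], with default [0] outside [S]. *)
have /choice[Z ZP] z : exists u, S z -> [/\ S u, N u <= C * N z &
    forall y, S y -> g u (Q (Q y)) = alpha z y].
  have [Sz|] := pselect (S z); last by exists 0.
  have [||| u [[v Sv vu] Nu gu]] :=
    @riesz _ _ g gP gC S (Q \o Q : {linear H -> H}) (alpha z) (C * N z) Ssub.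
  - by move=> k y y' Sy Sy'; exact: alin.
  - by rewrite mulr_ge0 ?hnorm_ge0 // ltW.
  - by move=> y Sy; exact: aC.
  exists u => _; split=> //.
  by apply: Scl vu => n /=; exact/QS/QS.
pose X k := iter k Z x.
have SX k : S (X k) by elim: k => //= k IH; case: (ZP _ IH).
have NX k : N (X k) <= C ^+ k * N x.
  elim: k => [|k IH] /=; first by rewrite mul1r.
  have [_ NZ _] := ZP _ (SX k); apply: le_trans NZ _.
  by rewrite exprS -mulrA ler_pM2l.
pose t i j := e (Q (X i)) (Q (X j)).
have tS i j : t i.+1 j = complex.Re (alpha (X i) (X j)).
  rewrite /t Qs //; last exact: QS.
  by have [_ _ /(_ _ (SX j))/= ->] := ZP _ (SX i).
(* Symmetry of [alpha] moves one [Z] across the form, so [t] depends on [i + j] only. *)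
have tE i j : t i j = t 0%N (i + j)%N.
  elim: i j => [//|i IH] j; rewrite addSnnS -IH tS asym // -tS.
  exact: re_sipC.
have t0E : t 0%N 0%N = N (Q x) ^+ 2 by rewrite hnorm_sqr.
have -> : complex.Re (alpha x x) = t 0%N 1%N by rewrite -(tS 0%N 0%N) tE.
rewrite mulrC -ler_pdivrMr //.
(* At dyadic indices Cauchy-Schwarz against [X 0] reads [b n ^+ 2 <= t 0 0 * b n.+1]; dividing by
   powers of [C] makes [b] bounded. *)
pose b n := t 0%N (2 ^ n)%N / C ^+ (2 ^ n).
have -> : t 0%N 1%N / C = b 0%N by rewrite /b expn0 expr1.
have Cn n : 0 < C ^+ n by rewrite exprn_gt0.
apply: (@ler_of_bounded_squaring _ b _ (N (Q x) * (`|K| * N x))).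
- exact: sqr_ge0.
- move=> n; rewrite /b expr_div_n -exprM mulrA expnSr muln2.
  rewrite ler_pM2r ?invr_gt0 // -t0E -addnn -tE.
  have := re_sip_CS gP (Q (X 0%N)) (Q (X (2 ^ n)%N)).
  by rewrite -/(t 0%N 0%N) -/(t _ _) -/(t _ _).
- move=> n; rewrite /b ler_pdivrMr // /t.
  apply: le_trans (re_sip_ler gP _ _) _; rewrite -!mulrA ler_wpM2l ?hnorm_ge0 //.
  apply: le_trans (QK _ (SX _)) _; apply: (@le_trans _ _ (`|K| * N (X (2 ^ n)%N))).
    by rewrite ler_wpM2r ?hnorm_ge0 ?ler_norm.
  by rewrite ler_wpM2l // mulrC NX.
Qed.

(** Douglas' lemma for one vector: Riesz gives [u] with [g u (Q x) = g v x], and symmetry of [Q]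
    turns this into [Q u = v]. *)
Lemma range_of_bound (S : set H) (Q : {linear H -> H}) (v : H) (C : R) :
  definite_form g -> linear_subspace S -> hclosed g S -> {homo Q : x / S x} ->
  (forall x y, S x -> S y -> g (Q x) y = g x (Q y)) -> S v -> 0 <= C ->
  (forall x, S x -> e v x <= C * N (Q x)) -> exists2 u, S u & Q u = v.
Proof.
move=> gD Ssub Scl QS Qs Sv C0 vC.
have [||| u [[w Sw wu] Nu gu]] := @riesz _ _ g gP gC S Q (g v) C Ssub.
- by move=> k x y _ _; rewrite sipDr // sipZr.
- exact: C0.
- exact: vC.
have Su : S u by apply: Scl wu => n /=; exact: QS.
exists u => //; apply: (subspace_sip_inj gP gD Ssub) => //; first exact: QS.
by move=> z Sz; rewrite Qs // gu.
Qed.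

(** Polarisation: [g (Q z) z] is real at [x], [y], [x + y] and [x + 'i y], which determines both the
    real and the imaginary part. *)
Lemma positive_sym (S : set H) (Q : {linear H -> H}) : linear_subspace S ->
  (forall x, S x -> 0 <= g (Q x) x) ->
  forall x y, S x -> S y -> g (Q x) y = g x (Q y).
Proof.
move=> Ssub Q0 x y Sx Sy.
have im0 z : S z -> complex.Im (g (Q z) z) = 0.
  by move=> /Q0; rewrite lecE => /andP[/eqP].
have i1 := im0 _ (subspaceD Ssub Sx Sy).
have i2 := im0 _ (subspaceD Ssub Sx (subspaceZ Ssub 'i%C Sy)).
move: i1 i2 (im0 _ Sx) (im0 _ Sy).
have -> : Q (x + y) = Q x + Q y by exact: linearD.
have -> : Q (x + 'i%C *: y) = Q x + 'i%C *: Q y by rewrite linearD linearZ.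
rewrite !(sipDl gP) !(sipDr gP) !(sipZl gP) !(sipZr gP) (semi_inner_conj gP (Q y) x).
case: (g (Q x) y) => a b; case: (g (Q y) x) => c d.
case: (g (Q x) x) => a1 b1; case: (g (Q y) y) => c1 d1 /=.
by move=> h1 h2 h3 h4; congr Complex; lra.
Qed.

End Reid.

(* A gliding hump: were the conclusion false, a Cauchy sequence s_n for g1 with
   |s_n|_2 >= n could be chosen, each step being so small that its g1-limit l still
   pairs with s_n like s_n itself, whence |s_n|_2 <= 1 + |l|_2. *)
Lemma hnorm_dominated (R : realType) (H : lmodType R[i]) (g1 g2 : H -> H -> R[i]) :
  semi_inner g1 -> definite_form g1 -> hcomplete setT g1 -> semi_inner g2 ->
  (forall s, exists K : R, forall x, complex.Re (g2 x s) <= K * hnorm g1 x) ->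
  exists2 C : R, 0 < C & forall x, hnorm g2 x <= C * hnorm g1 x.
Proof.
move=> g1P g1D g1C g2P; set N1 := hnorm g1; set N2 := hnorm g2 => sep.
apply: contrapT => nC.
have unb (C : R) : exists x, C * N1 x < N2 x.
  apply: contrapT => nx; apply: nC; exists (Num.max C 1).
    by rewrite lt_max ltr01 orbT.
  move=> x; rewrite leNgt; apply/negP => Cx; apply: nx; exists x.
  by apply: le_lt_trans Cx; rewrite ler_wpM2r ?hnorm_ge0 // le_max lexx.
(* A vector violating the bound with constant [(c + N2 s) / d], rescaled to [N1]-length [d], has
   [N2]-length at least [c + N2 s]; adding it to [s] leaves at least [c]. *)
have hump s (d c : R) : 0 < d -> 0 <= c -> exists s', N1 (s' - s) <= d /\ c <= N2 s'.
  move=> d0 c0; have [x0] := unb ((c + N2 s) / d).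
  have [Nx|Nx] := eqVneq (N1 x0) 0.
    by rewrite (hnorm_eq0 g1P g1D Nx) /N1 /N2 !hnorm0 // mulr0 ltxx.
  have Np : 0 < N1 x0 by rewrite lt_neqAle eq_sym Nx hnorm_ge0.
  move=> big; pose x := (d / N1 x0)%:C *: x0; exists (s + x).
  have dN : 0 <= d / N1 x0 by rewrite divr_ge0 // ltW.
  split; first by rewrite addrC addKr /N1 hnorm_real // ger0_norm // divfK.
  have : c + N2 s <= N2 x.
    rewrite /N2 (hnorm_real g2P) (ger0_norm dN) -ler_pdivrMl ?divr_gt0 // invf_div.
    apply: ltW; apply: le_lt_trans big; rewrite le_eqVlt; apply/orP; left.
    by rewrite -/(N2 s); apply/eqP; ring.
  have := ler_hnormB g2P (s + x) s; rewrite addrC addKr /N2; lra.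
(* A state is a vector with the radius left for later steps. The new radius is at most half the old
   one, and also so small that vectors within it pair with the new vector to at most 1. States of
   nonpositive radius get a default. *)
have /choice[G GP] (q : nat * (H * R)) : exists q' : H * R, 0 < q.2.2 ->
    [/\ 0 < q'.2, q'.2 <= q.2.2 / 2, N1 (q'.1 - q.2.1) <= q.2.2 / 2,
        q.1%:R <= N2 q'.1 &
        forall x, complex.Re (g2 x q'.1) * q'.2 <= N1 x].
  case: q => n [s d] /=; have [d0|] := ltP 0 d; last by exists (0, 0).
  have d2 : 0 < d / 2 by rewrite divr_gt0.
  have [s' [ss' ns']] := @hump s (d / 2) n%:R d2 (ler0n _ _).
  have [K Ks'] := sep s'; pose K' := Num.max K 1.
  have K'0 : 0 < K' by rewrite lt_max ltr01 orbT.
  exists (s', Num.min (d / 2) K'^-1) => _ /=; split=> //.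
  - by rewrite lt_min d2 invr_gt0.
  - by rewrite ge_min lexx.
  have m0 : 0 < Num.min (d / 2) K'^-1 by rewrite lt_min d2 invr_gt0.
  move=> x; apply: (@le_trans _ _ (K' * N1 x * Num.min (d / 2) K'^-1)).
    rewrite ler_pM2r //; apply: le_trans (Ks' x) _.
    by rewrite ler_wpM2r ?hnorm_ge0 // le_max lexx.
  rewrite mulrC mulrA ler_piMl ?hnorm_ge0 // -ler_pdivlMr // mul1r.
  by rewrite ge_min lexx orbT.
pose p := fix p n : H * R := if n is m.+1 then G (m, p m) else (0, 1).
pose sq n := (p n).1; pose d n := (p n).2.
have d0 n : 0 < d n by elim: n => [|n IH]; [exact: ltr01|case: (GP (n, p n) IH)].
have dS n : d n.+1 <= d n / 2 by case: (GP (n, p n) (d0 n)).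
have sS n : N1 (sq n.+1 - sq n) <= d n / 2 by case: (GP (n, p n) (d0 n)).
have N2s n : n%:R <= N2 (sq n.+1) by case: (GP (n, p n) (d0 n)).
have g2s n x : complex.Re (g2 x (sq n.+1)) * d n.+1 <= N1 x.
  by case: (GP (n, p n) (d0 n)) => _ _ _ _; apply.
have dle n : d n <= (2^-1) ^+ n.
  elim: n => [|n IH]; first by rewrite expr0.
  apply: le_trans (dS n) _; rewrite exprSr ler_pM2r //; lra.
(* A step is at most [d n / 2 <= d n - d n.+1], so the distances telescope. *)
have sdist m n : (m <= n)%N -> N1 (sq m - sq n) <= d m - d n.
  elim: n => [|n IH].
    by rewrite leqn0 => /eqP->; rewrite !subrr /N1 hnorm0.
  rewrite leq_eqVlt => /predU1P[->|]; first by rewrite !subrr /N1 hnorm0.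
  rewrite ltnS => /IH {}IH; rewrite -[sq m](subrK (sq n)) -addrA.
  apply: le_trans (ler_hnormD g1P _ _) _; rewrite (hnormBC g1P (sq n)) -/N1.
  by have := sS n; have := dS n; move: IH; lra.
have [l sl] : exists l, hcvg_to g1 sq l.
  have w0 : (fun n => (2^-1 : R) ^+ n) @ \oo --> (0 : R).
    by apply: cvg_expr; rewrite ger0_norm ?invr_ge0 // invf_lt1 // ltr1n.
  apply: (hcvg_sqr_dist g1P g1C w0) => m n /sdist smn.
  apply: le_trans (dle m).
  have dm1 : d m <= 1 by apply: le_trans (dle m) _; rewrite exprn_ile1 ?invr_ge0 // invf_le1 // ler1n.
  have := hnorm_ge0 g1 (sq m - sq n); have := d0 n; have := d0 m.
  by move: smn; rewrite /N1; nra.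
have lims n : N1 (sq n - l) <= d n.
  apply/ler_addgt0Pr => eps eps0.
  have /hcvgP /(_ eps eps0)[n0 n0P] := sl.
  have := n0P _ (leq_maxl n0 n); have := sdist _ _ (leq_maxr n0 n).
  set k := maxn n0 n => h1 h2; have := d0 k.
  have := ler_hnormD g1P (sq n - sq k) (sq k - l); rewrite addrA subrK -/N1.
  by move: h1 h2; rewrite -/N1; lra.
have N2l n : N2 (sq n.+1) ^+ 2 <= 1 + N2 l * N2 (sq n.+1).
  have := g2s n (sq n.+1 - l); have := lims n.+1; have := d0 n.+1 => dp h1 h2.
  have : complex.Re (g2 (sq n.+1 - l) (sq n.+1)) <= 1.
    by rewrite -(ler_pM2r dp) mul1r; apply: le_trans h2 h1.
  rewrite (re_sipDl g2P) (re_sipNl g2P) /N2 hnorm_sqr //.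
  have := re_sip_ler g2P l (sq n.+1); lra.
have l0 := hnorm_ge0 g2 l; rewrite -/N2 in l0.
(* For [k > 1 + N2 l], the value [N2 (sq k.+2) >= k + 1] is incompatible with the quadratic bound
   [N2l]. *)
have := archi_boundP (addr_ge0 ler01 l0); move: (Num.bound _) => k.
have := N2s k.+1; have := N2l k.+1; rewrite -natr1.
have := ler0n R k; nra.
Qed.

(** * Hilbert space structure of a signature operator *)

Section KreinSpaces.
Context {R : realType} {H : lmodType R[i]}.
Variable f : {hermitian H for false & (@Num.conj R[i])}.
Implicit Types (S : set H) (W J P : {linear H -> H}).

Lemma krein_conj x y : f y x = (f x y)^*%C.
Proof. by rewrite (hermC f) expr0 mul1r. Qed.

Section Signature.
Variable J : {linear H -> H}.
Hypothesis sJ : signature_operator f J.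
Local Notation g := (krein_inner f J).

(** The projections split [g] into [f] on [Hp] plus [- f] on [Hm], so positivity and completeness
    hold componentwise. A signature operator enters the later arguments through these five facts. *)
Lemma signature_facts : [/\ semi_inner g, definite_form g, hcomplete setT g,
  forall x, J (J x) = x & forall x y, f (J x) y = f x (J y)].
Proof.
have [Hp [Hm [Pp [Pm [decomp [PpK Ppr Ppk] [PmK Pmr Pmk] JE]]]]] := sJ.
have [Hpos Hneg orth sumH _] := decomp.
have PpH x : Hp (Pp x) by rewrite -Ppr; exists x.
have PmH x : Hm (Pm x) by rewrite -Pmr; exists x.
have Pp_id x : Hp x -> Pp x = x by rewrite -Ppr => -[z _ <-]; exact: PpK.
have Pm_id x : Hm x -> Pm x = x by rewrite -Pmr => -[z _ <-]; exact: PmK.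
have Pp0 x : Hm x -> Pp x = 0 by rewrite -Ppk.
have Pm0 x : Hp x -> Pm x = 0 by rewrite -Pmk.
have Psum x : x = Pp x + Pm x.
  have [y [z [Hy Hz ->]]] := sumH x.
  by rewrite !linearD Pp_id // (Pp0 z) // Pm0 // (Pm_id z) // addr0 add0r.
have fpm x y : f (Pp x) (Pm y) = 0 by exact: orth.
have fmp x y : f (Pm x) (Pp y) = 0 by rewrite krein_conj fpm conjc0.
have fE x y : f x y = f (Pp x) (Pp y) + f (Pm x) (Pm y).
  rewrite {1}(Psum x) {1}(Psum y) linearDl !linearDr /= fpm fmp.
  by rewrite addr0 add0r.
have PpJ x : Pp (J x) = Pp x by rewrite JE linearB PpK (Pp0 (Pm x)) // subr0.
have PmJ x : Pm (J x) = - Pm x by rewrite JE linearB PmK (Pm0 (Pp x)) // sub0r.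
have gE x y : g x y = f (Pp x) (Pp y) - f (Pm x) (Pm y).
  by rewrite /krein_inner fE PpJ PmJ linearNl.
have fp0 x : 0 <= f (Pp x) (Pp x).
  have [->|Pn] := eqVneq (Pp x) 0; first by rewrite linear0l.
  exact/ltW/(hilbert_pos Hpos).
have fm0 x : 0 <= - f (Pm x) (Pm x).
  have [->|Pn] := eqVneq (Pm x) 0; first by rewrite linear0l oppr0.
  exact/ltW/(hilbert_pos Hneg).
have gP : semi_inner g.
  split=> [k x y z|x y|x].
  - by rewrite /krein_inner linearP linearPl.
  - by rewrite !gE rmorphB /= -!krein_conj.
  - by rewrite gE addr_ge0.
have gD : definite_form g.
  move=> x /eqP; rewrite gE paddr_eq0 // => /andP[p0 m0].
  rewrite (Psum x); have [->|Pn] := eqVneq (Pp x) 0; last first.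
    by have := hilbert_pos Hpos (PpH x) Pn; rewrite lt_def p0.
  have [->|Pn] := eqVneq (Pm x) 0; last first.
    by have := hilbert_pos Hneg (PmH x) Pn; rewrite lt_def m0.
  by rewrite addr0.
split=> //.
- pose fm x y := - f x y.
  have re_gE x : complex.Re (g x x) =
      complex.Re (f (Pp x) (Pp x)) + complex.Re (fm (Pm x) (Pm x)).
    by rewrite gE /fm; case: (f _ _) => a b; case: (f (Pm x) _).
  have re_p x : 0 <= complex.Re (f (Pp x) (Pp x)).
    by have := fp0 x; rewrite lecE => /andP[].
  have re_m x : 0 <= complex.Re (fm (Pm x) (Pm x)).
    by have := fm0 x; rewrite lecE => /andP[].
  have Np x : hnorm f (Pp x) <= hnorm g x.
    by rewrite /hnorm ler_wsqrtr // re_gE lerDl.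
  have Nm x : hnorm fm (Pm x) <= hnorm g x.
    by rewrite /hnorm ler_wsqrtr // re_gE lerDr.
  have Ng x : hnorm g x <= hnorm f (Pp x) + hnorm fm (Pm x).
    apply: (hnorm_le gP); first by rewrite addr_ge0 ?hnorm_ge0.
    rewrite sqrrD /hnorm !sqr_sqrtr // re_gE lerD2r lerDl.
    by rewrite mulrn_wge0 // mulr_ge0 ?sqrtr_ge0.
  move=> u _ cu.
  have [n||lp Hlp ulp] := hilbert_complete Hpos (u := Pp \o u); first exact: PpH.
    move=> eps /cu[n0 n0P]; exists n0 => m n n0m n0n.
    by rewrite /= -linearB; apply: le_lt_trans (Np _) _; exact: n0P.
  have [n||lm Hlm ulm] := hilbert_complete Hneg (u := Pm \o u); first exact: PmH.
    move=> eps /cu[n0 n0P]; exists n0 => m n n0m n0n.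
    by rewrite /= -linearB; apply: le_lt_trans (Nm _) _; exact: n0P.
  exists (lp + lm) => //.
  have w0 : (fun n => hnorm f (Pp (u n) - lp) + hnorm fm (Pm (u n) - lm)) @ \oo
      --> (0 : R).
    by rewrite -(addr0 0); exact: cvgD ulp ulm.
  apply: (hcvg_squeeze w0) => n; apply: le_trans (Ng _) _.
  have Ppl : Pp (lp + lm) = lp by rewrite linearD Pp_id // Pp0 // addr0.
  have Pml : Pm (lp + lm) = lm by rewrite linearD Pm0 // Pm_id // add0r.
  have -> : Pp (u n - (lp + lm)) = Pp (u n) - lp by rewrite linearB Ppl.
  by have -> : Pm (u n - (lp + lm)) = Pm (u n) - lm by rewrite linearB Pml.
- by move=> x; rewrite (JE (J x)) PpJ PmJ opprK -Psum.
- by move=> x y; rewrite fE [RHS]fE !PpJ !PmJ linearNl linearNr.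
Qed.

End Signature.
End KreinSpaces.

(** * Weak complementability as a family of bounds *)

Section WeakComplementability.
Context {R : realType} {H : lmodType R[i]}.
Variables (g : H -> H -> R[i]) (S : set H).
Hypotheses (gP : semi_inner g) (gD : definite_form g) (gC : hcomplete setT g).
Hypotheses (Ssub : linear_subspace S) (Scl : hclosed g S).

Local Notation e x y := (complex.Re (g x y)).
Local Notation N x := (hnorm g x).

Lemma orthocompl_sym x y : S x -> orthocompl g S y -> g y x = 0.
Proof. by move=> Sx /(_ x Sx) gxy; rewrite (semi_inner_conj gP x) gxy conjc0. Qed.

(* Here [q] is the square root of the modulus [m] of the compression of [B]. *)
Lemma weakly_complementable_bound (B : {linear H -> H}) :
  (forall x y, g (B x) y = g x (B y)) -> weakly_complementable g S B ->
  exists a m q : {linear H -> H},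
    [/\ forall x, S x -> S (a x) /\ forall y, S y -> g (a x) y = g (B x) y,
        forall x, S x -> N (m x) = N (a x),
        forall x y, S x -> S y -> g (m x) y = g x (m y),
        forall x, S x -> e (m x) x = N (q x) ^+ 2 &
        forall y, exists2 C : R, 0 <= C & forall x, S x -> e (B y) x <= C * N (q x)].
Proof.
move=> Bs [a [b [bs [c [m [q [bf [a' [[aS _] [a'S _] aa'] [[mS _] m0 mm]] [[qS _] q0 qq] bq]]]]]]].
have ms := positive_sym gP Ssub m0.
have qs := positive_sym gP Ssub q0.
have aB x y : S x -> S y -> g (a x) y = g (B x) y.
  move=> Sx Sy; rewrite (block_S bf Sx) sipDl //.
  by rewrite (orthocompl_sym Sy (block_bs bf Sx)) addr0.
have Nma x : S x -> N (m x) = N (a x).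
  move=> Sx; have Sax := aS _ Sx; congr (Num.sqrt (complex.Re _)).
  rewrite -ms ?mm //=; last exact: mS.
  by rewrite (semi_inner_conj gP) -aa' // -(semi_inner_conj gP).
have mq x y : S x -> S y -> g (m x) y = g (q x) (q y).
  by move=> Sx Sy; rewrite -qq // qs //; exact: qS.
exists a, m, q; split=> //.
- by move=> x Sx; split; [exact: aS|move=> y; exact: aB].
- by move=> x Sx; rewrite mq // -hnorm_sqr.
(* The component of [y] orthogonal to [S] is covered by [b (y - P y) = q w]. For [P y], Riesz gives
   [g (a (P y)) x = g u (m x)], which equals [g (q u) (q x)]. *)
move=> y; have [P [SP Pid gPx]] := orthoprojector_exists gP gD gC Ssub Scl.
have Sty : orthocompl g S (y - P y).
  move=> x Sx; rewrite (semi_inner_conj gP (y - P y)) sipBl // gPx // subrr.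
  exact: conjc0.
have [w Sw qw] : (q @` S) (b (y - P y)) by apply: bq; exists (y - P y).
have [||| u [[v Sv vu] Nu gu]] :=
  @riesz _ _ g gP gC S m (g (a (P y))) (N (P y)) Ssub.
- by move=> k z z' _ _; rewrite sipDr // sipZr.
- exact: hnorm_ge0.
- move=> x Sx; rewrite Nma // aB // Bs (semi_inner_conj gP (B x)) -aB //.
  by rewrite -(semi_inner_conj gP); exact: re_sip_ler.
have Su : S u by apply: Scl vu => n /=; exact: mS.
exists (N (q u) + N w); first by rewrite addr_ge0 ?hnorm_ge0.
move=> x Sx.
have -> : B y = B (P y) + B (y - P y) by rewrite -linearD addrC subrK.
rewrite re_sipDl // -aB // -gu // -ms // mq //.
rewrite (block_orth bf Sty) re_sipDl // (orthocompl_sym Sx (block_c bf Sty)) addr0.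
rewrite -qw (qs w) // mulrDl lerD //; exact: re_sip_ler.
Qed.

Lemma orthoprojector_sym P : orthoprojector g S P -> forall x y, g (P x) y = g x (P y).
Proof.
move=> [SP _ gPx] x y; rewrite (semi_inner_conj gP y) -gPx //.
by rewrite -(semi_inner_conj gP) gPx.
Qed.

(** Operators on [S] are restrictions of maps on [H], so the compression is extended as [P B P] and
    its modulus and root are built on all of [H]. The bound comes as the premise of an implication
    because it has to be checked for this very [q]. *)
Lemma weakly_complementable_intro (B : {linear H -> H}) (M : R) :
  (forall x y, g (B x) y = g x (B y)) -> (forall x, N (B x) <= M * N x) ->
  exists P q : {linear H -> H},
    [/\ orthoprojector g S P, {homo q : x / S x},
        forall x y, g (q x) y = g x (q y),
        exists K : R, forall x, N (q x) <= K * N x &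
        (forall x, S x -> N (q (q x)) = N (P (B x))) /\
        ((forall y, exists2 C : R, 0 <= C & forall x, S x -> e (B y) x <= C * N (q x)) ->
         weakly_complementable g S B)].
Proof.
move=> Bs BM.
have [P PP] := orthoprojector_exists gP gD gC Ssub Scl.
have [SP Pid gPx] := PP; have Ps := orthoprojector_sym PP.
have NP x : N (P x) <= N x by exact: hnorm_proj PP.
pose a : {linear H -> H} := P \o (B \o P).
have as_ x y : g (a x) y = g x (a y) by rewrite /= Ps Bs Ps.
have aM x : N (a x) <= `|M| * N x.
  apply: le_trans (NP _) _; apply: le_trans (BM _) _.
  apply: (@le_trans _ _ (`|M| * N (P x))); last by rewrite ler_wpM2l.
  by rewrite ler_wpM2r ?hnorm_ge0 // ler_norm.
have aS : {homo a : x / S x} by move=> x _; exact: SP.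
(* Since [a] is symmetric, this is [a^* a]. *)
pose t : {linear H -> H} := a \o a.
have [|||| m [mS ms m0 mm [Km mK]]] := @sqrt_exists _ _ g gP gD gC S t (`|M| * `|M|) Ssub Scl.
- by move=> x y; rewrite /t [LHS]as_ [LHS]as_.
- by move=> x; rewrite /t [X in _ <= X]as_; exact: semi_inner_ge0.
- by move=> x; apply: le_trans (aM _) _; rewrite -mulrA ler_wpM2l.
- by move=> x Sx; exact/aS/aS.
have [|||| q [qS qs q0 qq [Kq qK]]] := @sqrt_exists _ _ g gP gD gC S m Km Ssub Scl => //.
exists P, q; split=> //; first by exists Kq.
split=> [x Sx|range_cond].
  have -> : P (B x) = a x by rewrite /= (Pid x).
  by congr (Num.sqrt (complex.Re _)); rewrite qq ms mm /t -[LHS]as_.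
pose b : {linear H -> H} := P \o B.
(* One map serves as [b^*] on [S] and as the last block on the complement. *)
have [c cE] : exists c : {linear H -> H}, forall x, c x = B x - P (B x).
  apply: linear_exists => k x y.
  have -> : P (B (k *: x + y)) = k *: P (B x) + P (B y) by rewrite !linearP.
  rewrite linearP scalerBr opprD addrACA.
  by [].
have c_orth x : orthocompl g S (c x).
  move=> y Sy; rewrite cE (semi_inner_conj gP) sipBl // gPx // subrr.
  exact: conjc0.
exists a, b, c, c, m, q; split.
- split=> //.
  + by move=> y _; exact: SP.
  + move=> x y Sx Sy; rewrite /= gPx // Bs cE sipBr //.
    by rewrite (orthocompl_sym (SP _) Sy) subr0.
  + by move=> x Sx; rewrite cE /= (Pid x) // addrC subrK.
  + by move=> y _; rewrite cE /= addrC subrK.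
- exists a.
    by split=> //; split=> //; exists `|M| => x _; exact: aM.
  by split; [split=> //; exists Km => x _; exact: mK|move=> x _|move=> x _; exact: mm].
- by split; [split=> //; exists Kq => x _; exact: qK|move=> x _|move=> x _; exact: qq].
move=> _ [y _ <-]; have [C C0 yC] := range_cond y.
have bC x : S x -> e (b y) x <= C * N (q x).
  by move=> Sx; rewrite /= gPx //; exact: yC.
have [x Sx qx] := range_of_bound gP gC gD Ssub Scl qS (fun x y _ _ => qs x y) (SP _) C0 bC.
by exists x.
Qed.

End WeakComplementability.

(** * Change of signature operator *)

Section SignatureChange.
Context {R : realType} {H : lmodType R[i]}.
Variable f : {hermitian H for false & (@Num.conj R[i])}.
Implicit Types (J W : {linear H -> H}) (S : set H).

Local Notation N J x := (hnorm (krein_inner f J) x).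

Lemma signature_hnorm J x : signature_operator f J -> N J (J x) = N J x.
Proof.
move=> sJ; have [_ _ _ JJ Js] := signature_facts sJ.
by rewrite /hnorm /krein_inner Js !JJ Js.
Qed.

(** The pairing <x, s>_J' equals <Jx, J's>_J, hence is continuous in [x] for the norm of [J], which
    is the hypothesis of the gliding hump. *)
Lemma signature_hnorm_le J J' : signature_operator f J -> signature_operator f J' ->
  exists2 C : R, 0 < C & forall x, N J' x <= C * N J x.
Proof.
move=> sJ sJ'; have [gP gD gC JJ _] := signature_facts sJ.
have [gP' _ _ _ Js'] := signature_facts sJ'.
apply: hnorm_dominated => // s; exists (N J (J' s)) => x.
have -> : krein_inner f J' x s = krein_inner f J (J x) (J' s).
  by rewrite /krein_inner JJ Js'.
by apply: le_trans (re_sip_ler gP _ _) _; rewrite signature_hnorm // mulrC.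
Qed.

Lemma krein_closed_signature J S : signature_operator f J -> krein_closed f S ->
  hclosed (krein_inner f J) S.
Proof.
move=> sJ [J0 sJ0 Scl] u l Su ul; apply: (Scl u) => //.
have [gP0 _ _ _ _] := signature_facts sJ0.
have [C _ CN] := signature_hnorm_le sJ sJ0.
have w0 : (fun n => C * N J (u n - l)) @ \oo --> (0 : R).
  by rewrite -(mulr0 C); exact: cvgMl_tmp.
exact: hcvg_squeeze w0 _.
Qed.

Lemma krein_bounded_signature J W : signature_operator f J -> krein_bounded f W ->
  exists M : R, forall x, N J (W x) <= M * N J x.
Proof.
move=> sJ [J0 sJ0 [_ [M WM]]].
have [C C0 CN] := signature_hnorm_le sJ0 sJ.
have [D D0 DN] := signature_hnorm_le sJ sJ0.
exists (C * (`|M| * D)) => x; apply: le_trans (CN _) _.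
rewrite -!mulrA ler_pM2l //; apply: le_trans (WM _ I) _.
apply: (@le_trans _ _ (`|M| * N J0 x)); last by rewrite ler_wpM2l.
by rewrite ler_wpM2r ?hnorm_ge0 // ler_norm.
Qed.

End SignatureChange.

Theorem theorem4p4 (R : realType) (H : lmodType R[i])
    (f : {hermitian H for false & (@Num.conj R[i])})
    (W : {linear H -> H}) (S : set H) :
  krein_space f ->
  krein_selfadjoint f W ->
  linear_subspace S -> krein_closed f S ->
  (exists2 J : {linear H -> H},
      signature_operator f J & krein_weakly_complementable f S J W) ->
  forall Ja : {linear H -> H},
    signature_operator f Ja -> krein_weakly_complementable f S Ja W.
Proof.
move=> _ [Wb Ws] Ssub Scl [J sJ wcJ] Ja sJa.
have [gP gD gC JJ Jsym] := signature_facts sJ.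
have [hP hD hC JJa Jasym] := signature_facts sJa.
have gScl := krein_closed_signature sJ Scl.
have hScl := krein_closed_signature sJa Scl.
have [c1 c10 hg] := signature_hnorm_le sJ sJa.
have [c2 c20 gh] := signature_hnorm_le sJa sJ.
set g := krein_inner f J in gP gD gC gScl hg gh.
set h := krein_inner f Ja in hP hD hC hScl hg gh.
pose B : {linear H -> H} := J \o W; pose Ba : {linear H -> H} := Ja \o W.
have gB x y : g (B x) y = f (W x) y by rewrite /g /krein_inner /= JJ.
have hB x y : h (Ba x) y = f (W x) y by rewrite /h /krein_inner /= JJa.
have Bs x y : g (B x) y = g x (B y) by rewrite gB Ws /g /krein_inner /= Jsym JJ.
have Bas x y : h (Ba x) y = h x (Ba y) by rewrite hB Ws /h /krein_inner /= Jasym JJa.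
have [M BaM] : exists M : R, forall x, hnorm h (Ba x) <= M * hnorm h x.
  have [M WM] := krein_bounded_signature sJa Wb.
  by exists M => x; rewrite /Ba /= signature_hnorm.
have [a [m [q [aP Nm ms mq Bq]]]] :=
  weakly_complementable_bound gP gD gC Ssub gScl Bs wcJ.
have [P [p [[SP Pid hPx] pS ps [K pK] [pp intro]]]] :=
  weakly_complementable_intro hP hD hC Ssub hScl Bas BaM.
apply: intro => y.
(* [Wx, ax] is both the squared [g]-norm of [a x] and the [h]-pairing of [P (Ba x)] with [a x]; [hg]
   contributes [c1]. *)
have Na x : S x -> hnorm g (a x) <= c1 * hnorm h (p (p x)).
  move=> Sx; have [Sax ax] := aP x Sx; rewrite pp //.
  apply: (hnorm_le_self gP); first by rewrite mulr_ge0 ?hnorm_ge0 // ltW.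
  rewrite ax // gB -hB -hPx //; apply: le_trans (re_sip_ler hP _ _) _.
  by rewrite [leRHS]mulrAC [leRHS]mulrC ler_wpM2l ?hnorm_ge0.
have qp x : S x -> hnorm g (q x) <= Num.sqrt (c1 * c2) * hnorm h (p x).
  move=> Sx; apply: (hnorm_le gP).
    by rewrite mulr_ge0 ?hnorm_ge0 ?sqrtr_ge0.
  rewrite -hnorm_sqr // -mq // exprMn sqr_sqrtr; last by rewrite mulr_ge0 // ltW.
  (* In the constant [c1 * c2], [c2] converts the [g]-norm of the first argument and [c1] comes from
     [Na]. *)
  apply: (reid hP hC (alpha := fun x y => g (m x) y) Ssub hScl pS) => //.
  - by move=> k z z' z'' _ _ _; rewrite sipDr // sipZr.
  - by move=> z z' Sz Sz'; rewrite ms // re_sipC.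
  - by rewrite mulr_gt0.
  move=> z z' Sz Sz'; rewrite ms //; apply: le_trans (re_sip_ler gP _ _) _.
  rewrite Nm // (mulrC c1) -[c2 * c1 * _]mulrA [c1 * _]mulrC mulrA -mulrA.
  by rewrite ler_pM ?hnorm_ge0 ?Na.
have [C C0 CB] := Bq y.
exists (C * Num.sqrt (c1 * c2)); first by rewrite mulr_ge0 // sqrtr_ge0.
move=> x Sx; rewrite hB -gB; apply: le_trans (CB x Sx) _.
by rewrite -mulrA ler_wpM2l // qp.
Qed.
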